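(* For every integer $k\geq 1$, $\mathsf{APS}^B_{2k} = \mathsf{APS}^D_{2k}$.
   Context: For $n\in\mathbb{N}$, $[n]=\{1,\dots,n\}$ and $\pm[n]=[n]\cup -[n]$. The group $\mathfrak{S}_n^B$ of signed permutations consists of the bijections $w:\pm[n]\to\pm[n]$ with $w(-i)=-w(i)$ for all $i$, written in one-line notation $w(1)\cdots w(n)$. $\mathfrak{S}_n^D\subseteq\mathfrak{S}_n^B$ is the subgroup of those $w$ for which $|\{i\in[n]: w(i)<0\}|$ is even. A pinnacle of $w$ is a value $w(i)$ with $2\le i\le n-1$ and $w(i-1)<w(i)>w(i+1)$; the pinnacle set of $w$ is the set of its pinnacles. $\mathsf{APS}^B_n$ (resp. $\mathsf{APS}^D_n$) is the set of subsets of $\pm[n]$ that are the pinnacle set of some $w\in\mathfrak{S}_n^B$ (resp. $w\in\mathfrak{S}_n^D$). *)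

(* Defs.v *)
From HB Require Import structures.
From mathcomp Require Import all_boot all_order all_algebra all_fingroup.

Set Implicit Arguments.
Unset Strict Implicit.
Unset Printing Implicit Defensive.

Import Order.TTheory GRing.Theory Num.Theory.

Local Open Scope ring_scope.

Definition pm_seq (n : nat) : seq int :=
  [seq (m%:Z : int) | m <- iota 1 n] ++ [seq - (m%:Z : int) | m <- iota 1 n].

Lemma mem_pm_seq (n : nat) (x : int) :
  (x \in pm_seq n) = (0 < `|x| <= n)%N.
Proof.
rewrite mem_cat; apply/orP/idP => [[] /mapP[m + ->]|].
- by rewrite mem_iota add1n ltnS absz_nat.
- by rewrite mem_iota add1n ltnS abszN absz_nat.
move=> hx; have hm : `|x|%N \in iota 1 n by rewrite mem_iota add1n ltnS.
case: (leP 0 x) => x0; [left | right]; apply/mapP; exists `|x|%N => //.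
  by rewrite abszE ger0_norm.
by rewrite abszE ltr0_norm // opprK.
Qed.

(* The set ±[n], as a finite subtype of int: [val] is its inclusion in int. *)
Definition pm (n : nat) : Type := seq_sub (pm_seq n).
HB.instance Definition _ (n : nat) := SubFinite.on (pm n).

Lemma pm_oppP (n : nat) (i : pm n) : - val i \in pm_seq n.
Proof. by rewrite mem_pm_seq abszN -mem_pm_seq; exact: valP. Qed.

Definition pm_opp (n : nat) (i : pm n) : pm n := Sub (- val i) (pm_oppP i).

Definition signed_perms (n : nat) : {set {perm pm n}} :=
  [set w : {perm pm n} | [forall i, w (pm_opp i) == pm_opp (w i)]].

Definition even_signed_perms (n : nat) : {set {perm pm n}} :=
  [set w in signed_perms n |
    ~~ odd #|[set i : pm n | (0 < val i) && (val (w i) < 0)]|].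

(* [h] and [j] are the positions i - 1 and i + 1, which belong to [n] when
   2 <= i <= n - 1. *)
Definition peak (n : nat) (w : {perm pm n}) (i : pm n) : bool :=
  (2 <= val i <= n%:Z - 1) &&
  [exists h : pm n, exists j : pm n,
    [&& val h == val i - 1, val j == val i + 1,
        val (w h) < val (w i) & val (w j) < val (w i)]].

Definition pinnacle_set (n : nat) (w : {perm pm n}) : {set pm n} :=
  [set w i | i in [set i : pm n | peak w i]].

Definition APS_B (n : nat) : {set {set pm n}} :=
  [set pinnacle_set w | w in signed_perms n].

Definition APS_D (n : nat) : {set {set pm n}} :=
  [set pinnacle_set w | w in even_signed_perms n].

(* Main.v *)
Require Import Defs.
From mathcomp Require Import all_boot.
From mathcomp Require Import all_order all_algebra all_fingroup zify.

Set Implicit Arguments.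
Unset Strict Implicit.
Unset Printing Implicit Defensive.

Import Order.TTheory GRing.Theory Num.Theory.

(** Let [w] have an odd number of negative entries, and read its one-line word
    with a letter larger than all others added at both ends.  Valleys outnumber
    peaks by one, so, the length being even, some entry [x] is neither a peak
    nor a valley, and deleting it changes no pinnacle.  A new value [y] larger
    than the minimum of the remaining word [u] can be inserted where [u] first
    drops below [y], again without changing the pinnacles.  If [- x] exceeds
    [min u], insert it.  Otherwise [x] is positive and [min u] negative: put
    [- x] at the place of the minimum of [u], which keeps it a valley, and
    insert the former minimum.  In both cases exactly one sign changes. *)

(** * Pinnacles of integer words under insertion and deletion of letters *)

Section Words.
Local Open Scope ring_scope.

Fixpoint pinnacles (s : seq int) : seq int :=
  if s is a :: t then
    if t is b :: c :: _ then
      if (a < b) && (c < b) then b :: pinnacles t else pinnacles t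
    else [::]
  else [::].

Lemma mem_pinnacles (s : seq int) (x : int) :
  reflect (exists i, [/\ (i.+2 < size s)%N, nth 0 s i < nth 0 s i.+1,
                         nth 0 s i.+2 < nth 0 s i.+1 & x = nth 0 s i.+1])
          (x \in pinnacles s).
Proof.
apply: (iffP idP).
  elim: s => [//|a [//|b [//|c s]] IH] /=; case: ifP => [/andP[ab cb]|_].
    rewrite inE => /orP[/eqP->|/IH[i [? ? ? ?]]]; first by exists 0%N.
    by exists i.+1.
  by move=> /IH[i [? ? ? ?]]; exists i.+1.
case=> i; elim: s i => [|a [|b [|c s]] IH] [|i] //= [hi h1 h2 xE] //.
  by rewrite h1 h2 xE inE eqxx.
have hx := IH i (And4 hi h1 h2 xE).
by case: ifP => // _; rewrite inE hx orbT.
Qed.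

Lemma pinnacles_descent (a b : int) (s : seq int) :
  b < a -> pinnacles (a :: b :: s) = pinnacles (b :: s).
Proof. by case: s => [//|c s] ba /=; rewrite ltNge ltW. Qed.

(** The letter [y] lands inside a descent, or at the front before a smaller letter, so it is no
    peak; each neighbour still meets a letter on the same side of it as before. *)
Lemma pinnacles_insert (y b : int) (l r : seq int) :
  b < y -> all (> y) l ->
  pinnacles (l ++ y :: b :: r) = pinnacles (l ++ b :: r).
Proof.
move=> lt_by; elim: l => [_|a [_ /andP[ya _]|c l IH /andP[ya]]].
- exact: pinnacles_descent.
- by rewrite !cat1s !pinnacles_descent // (lt_trans lt_by).
move=> /[dup] /andP[/= yc _] /IH /= {}IH.
by case: l IH => [|d l] /= ->; rewrite ?yc ?(lt_trans lt_by yc).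
Qed.

(** Both [y] and [v] lie below every other letter, so no comparison between neighbours changes. *)
Lemma pinnacles_lower_min (y v : int) (l r : seq int) :
  y < v -> all (> v) (l ++ r) ->
  pinnacles (l ++ y :: r) = pinnacles (l ++ v :: r).
Proof.
move=> yv; elim: l => [|a [_|c l IH]].
- by case: r => [//|b [//|c r]] /= /andP[vb _]; rewrite vb (lt_trans yv).
- case: r => [//|b r] /= /and3P[va vb _].
  rewrite (ltNge a y) (ltNge a v) (ltW va) (ltW (lt_trans yv va)) /=.
  by case: r => [//|c r]; rewrite vb (lt_trans yv vb).
move=> /= /andP[va] /[dup] /andP[vc _] /IH /= {}IH.
by case: l IH => [|d l] /= ->; rewrite ?vc ?(lt_trans yv vc).
Qed.

Lemma insert_letter (y : int) (u : seq int) :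
  has (< y) u -> y \notin u ->
  exists2 s, perm_eq s (y :: u) & pinnacles s = pinnacles u.
Proof.
move=> hu yu; case: (split_find hu) yu => b l r lt_by hl yu.
rewrite cat_rcons; exists (l ++ y :: b :: r); first by rewrite -cat1s perm_catCA.
apply: pinnacles_insert => //; apply/allP => a al.
(* The letters before the first one below [y] are at least [y]; freshness of [y] makes this
   strict. *)
move/hasPn/(_ a al): hl; rewrite -leNgt le_eqVlt => /orP[/eqP ya|//].
by move: yu; rewrite cat_rcons mem_cat ya al.
Qed.

Lemma seq_minimum (h : int) (t : seq int) :
  exists2 v, v \in h :: t & forall z, z \in h :: t -> v <= z.
Proof.
elim: t h => [|a t IH] h; first by exists h; rewrite ?mem_head// => z /[!inE] /eqP->.
have [v vt vmin] := IH a; case: (leP h v) => hv.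
  exists h; rewrite ?mem_head// => z; rewrite inE => /orP[/eqP->//|/vmin].
  exact: le_trans.
exists v; first by rewrite inE vt orbT.
by move=> z; rewrite inE => /orP[/eqP->|/vmin//]; apply: ltW.
Qed.

(* The bound [h' <= h] on the first letter keeps a preceding peak a peak in the
   induction; the smaller letter expresses that [x] is not a global minimum. *)
Lemma delete_letter (h : int) (t : seq int) :
  uniq (h :: t) -> odd (size t) ->
  exists x h' t', [/\ perm_eq (h :: t) (x :: h' :: t'), h' <= h,
    has (< x) (h' :: t') & pinnacles (h' :: t') = pinnacles (h :: t)].
Proof.
have [m] := ubnP (size t); elim: m h t => // m IH a [//|b s] + us os.
have ab : a != b by move: us; rewrite /= inE negb_or => /andP[/andP[]].
case: (ltgtP a b) ab => // [ab|ba] _ hm; last first.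
  (* With a larger letter imagined in front, [a] is a double descent. *)
  by exists a, b, s; rewrite perm_refl ltW // pinnacles_descent //= ba.
case: s us os hm => [|c s] us os hm.
  (* With a larger letter imagined at the end, [b] is a double ascent. *)
  by exists b, a, [::]; rewrite /= ab lexx (perm_catC [:: a] [:: b]).
have bc : b != c.
  by move: us; rewrite /= !inE !negb_or => /and3P[_ /andP[]].
case: (ltgtP b c) bc => // [bc|cb] _.
  (* Here [a < b < c], so [b] is a double ascent. *)
  exists b, a, (c :: s); split=> //=; rewrite ?ab //.
    by rewrite (perm_catCA [:: a] [:: b]).
  rewrite [c < b]ltNge ltW //=.
  by case: s {us os hm} => [//|d s]; rewrite bc (lt_trans ab bc).
(* Here [b] is a peak. Dropping the valley [a] and the peak [b] preserves the parity of the
   length. *)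
have [|||x [h' [t' [ps h'c hx pE]]]] := IH c s.
- by move: hm => /=; lia.
- by case/and3P: us.
- by move: os => /=; rewrite negbK.
exists x, a, (b :: h' :: t'); split=> //.
- by rewrite perm_sym (perm_catCA [:: x] [:: a; b]) (perm_cat2l [:: a; b]) perm_sym.
- by move: hx => /=; lia.
have h'b : h' < b := le_lt_trans h'c cb.
have eb : pinnacles [:: b, h' & t'] = pinnacles [:: b, c & s].
  by rewrite !pinnacles_descent.
by move: eb => /= ->; rewrite ab cb h'b.
Qed.

Lemma flip_sign_parity (n : nat) (s : seq int) :
  (0 < n)%N -> ~~ odd n -> perm_eq (map absz s) (iota 1 n) ->
  odd (count (< 0) s) ->
  exists s', [/\ perm_eq (map absz s') (iota 1 n),
    ~~ odd (count (< 0) s') & pinnacles s' = pinnacles s].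
Proof.
move=> n0 en ps ods; have us : uniq (map absz s) by rewrite (perm_uniq ps) iota_uniq.
have sz : size s = n by rewrite -(size_map absz) (perm_size ps) size_iota.
case: s ps ods us sz => [|h t] ps ods us sz; first by move: n0; rewrite -sz.
have [|x [h' [t' [pu _ hx pE]]]] := @delete_letter h t (map_uniq us).
  by move: en; rewrite -sz /= negbK.
have [v vu vmin] := seq_minimum h' t'.
move: pu hx pE vu vmin; move: (h' :: t') => u pu hx <- vu vmin {h' t'}.
have pa : perm_eq (map absz (x :: u)) (iota 1 n).
  by rewrite -(permPl (perm_map absz pu)).
have ua : uniq (map absz (x :: u)) by rewrite (perm_uniq pa) iota_uniq.
(* Hence exactly one of [x] and [- x] is negative. *)
have x0 : x != 0.
  have: `|x|%N \in iota 1 n by rewrite -(perm_mem pa) mem_head.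
  by rewrite mem_iota; lia.
have xu z : z \in u -> `|z|%N != `|x|%N.
  by move: ua => /= /andP[xn _] zu; apply: contraNneq xn => <-; apply: map_f.
have {}ods : odd (count (< 0) (x :: u)) by rewrite -(seq.permP pu).
have [hN|hN] := boolP (has (< - x) u).
  have [|s' ps' <-] := insert_letter hN.
    by apply/negP => /xu; rewrite abszN eqxx.
  exists s'; split=> //.
    by rewrite (perm_trans (perm_map absz ps')) //= abszN.
  by move: ods; rewrite (seq.permP ps') /=; lia.
(* No letter of [u] is below [- x], and none equals it since absolute values are distinct. *)
have gtu z : z \in u -> - x < z.
  by move=> zu; move/hasPn/(_ z zu): hN; move/(_ z zu): xu => /=; lia.
(* Some letter of [u] lies below [x], hence strictly between [- x] and [x]. *)
have xp : 0 < x by case/hasP: hx => z /gtu /=; lia.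
(* As [x] is positive, the odd number of negative letters all lie in [u]. *)
have /hasP[z zu z0] : has (< 0) u by rewrite has_count; move: ods => /=; lia.
have vx := gtu v vu; have v0 := le_lt_trans (vmin z zu) z0.
case/splitPr: vu pa ua ods vmin {pu hx hN gtu zu xu} => l r.
move=> pa ua ods vmin; have : uniq (v :: l ++ r).
  have -> : uniq (v :: l ++ r) = uniq (l ++ v :: r).
    by apply: perm_uniq; rewrite -(cat1s v) perm_catCA.
  by case/andP: ua => _; apply: map_uniq.
case/andP => vlr _.
have lrE z' : (z' \in l ++ v :: r) = (z' == v) || (z' \in l ++ r).
  by rewrite !mem_cat inE orbCA.
(* Now [- x] stands where the minimum [v] stood, and being smaller than [v] it allows [v] to be
   inserted again. *)
have [||s' ps' pE] := @insert_letter v (l ++ - x :: r).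
- by rewrite has_cat /= vx orbT.
- by rewrite mem_cat inE orbCA -mem_cat (negPf vlr) orbF gt_eqF.
exists s'; split.
- rewrite (perm_trans (perm_map absz ps')) // -(permPr pa) /= !map_cat /= abszN.
  by apply/seq.permP => p; rewrite /= !count_cat /=; lia.
- by move: ods; rewrite (seq.permP ps') /= !count_cat /=; lia.
rewrite pE; apply: pinnacles_lower_min => //; apply/allP => a alr.
rewrite lt_neqAle vmin ?lrE ?alr ?orbT // andbT.
by apply: contraNneq vlr => ->.
Qed.

End Words.

(** * Dictionary between signed permutations and their one-line words *)

Section OneLineNotation.
Local Open Scope ring_scope.
Variable n : nat.
Implicit Types (w : {perm pm n}) (i : pm n).

(** The default [0] is never reached, since every [m] in [iota 1 n] belongs to [pm n]. *)
Definition word w : seq int :=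
  [seq oapp (fun i => val (w i)) 0 (insub m%:Z) | m <- iota 1 n].

Lemma pm_bounds i : (0 < `|val i| <= n)%N.
Proof. by rewrite -mem_pm_seq; apply: valP. Qed.

Lemma pm_at (m : nat) : (m < n)%N -> {i : pm n | val i = m.+1%:Z}.
Proof.
move=> mn; have mP : m.+1%:Z \in pm_seq n by rewrite mem_pm_seq.
by exists (Sub m.+1%:Z mP); rewrite SubK.
Qed.

Lemma size_word w : size (word w) = n.
Proof. by rewrite size_map size_iota. Qed.

Lemma nth_word w i (m : nat) : val i = m.+1%:Z -> nth 0 (word w) m = val (w i).
Proof.
move=> iE; have := pm_bounds i; rewrite iE => mn.
rewrite (nth_map 0%N) ?size_iota // nth_iota // add1n -iE.
by rewrite valK.
Qed.

Lemma val_pm_opp i : val (pm_opp i) = - val i.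
Proof. by rewrite SubK. Qed.

Lemma word_abs w : w \in signed_perms n ->
  perm_eq (map absz (word w)) (iota 1 n).
Proof.
rewrite inE => /forallP wN.
have sz : size (map absz (word w)) = size (iota 1 n).
  by rewrite size_map size_word size_iota.
have nthE m (mn : (m < n)%N) :
    nth 0%N (map absz (word w)) m = `|val (w (sval (pm_at mn)))|%N.
  by rewrite (nth_map 0) ?size_word // (nth_word _ (svalP (pm_at mn))).
have uw : uniq (map absz (word w)).
  apply/(uniqP 0%N) => a b; rewrite !inE size_map size_word => an bn.
  rewrite (nthE a an) (nthE b bn).
  case: (pm_at an) (pm_at bn) => i iE [j jE] /= wE.
  (* The second alternative gives [w i = w (- j)], hence [i = - j], impossible for positive
     positions. *)
  have : val (w i) = val (w j) \/ val (w i) = - val (w j).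
    by move: wE => /=; lia.
  case=> [/val_inj/perm_inj ij|]; first by move: iE jE; rewrite ij => ->; lia.
  rewrite -val_pm_opp -(eqP (wN j)) => /val_inj/perm_inj ij.
  by move: iE; rewrite ij val_pm_opp jE; lia.
apply: uniq_perm; rewrite ?iota_uniq //.
have [||_] := @uniq_min_size _ _ (iota 1 n) uw => //; last by rewrite sz.
move=> y /(nthP 0%N)[m]; rewrite size_map size_word => mn <-.
by rewrite (nthE m mn) mem_iota add1n ltnS pm_bounds.
Qed.

Lemma mem_pinnacle_set w i :
  (i \in pinnacle_set w) = (val i \in pinnacles (word w)).
Proof.
apply/imsetP/mem_pinnacles => [[j + ->]|[m]].
  rewrite inE => /andP[/andP[j2 jn] /existsP[h /existsP[k]]].
  case/and4P => /eqP hE /eqP kE wh wk.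
  (* Positions start at 1 and indices at 0, so [m] is the index of the left neighbour of the
     peak. *)
  have [m jE] : exists m : nat, val j = m.+2%:Z.
    by exists (`|val j| - 2)%N; move: (val j) j2; lia.
  have {}hE : val h = m.+1%:Z by rewrite hE jE; lia.
  have {}kE : val k = m.+3%:Z by rewrite kE jE; lia.
  exists m; rewrite size_word (nth_word _ hE) (nth_word _ jE) (nth_word _ kE).
  by split=> //; move: jn; rewrite jE; lia.
rewrite size_word => -[mn].
have [h hE] := pm_at (ltnW (ltnW mn)); have [j jE] := pm_at (ltnW mn).
have [k kE] := pm_at mn.
rewrite (nth_word _ hE) (nth_word _ jE) (nth_word _ kE) => wh wk /val_inj ->.
exists j => //; rewrite inE /peak; apply/andP; split; first by rewrite jE; lia.
by apply/existsP; exists h; apply/existsP; exists k; rewrite wh wk hE jE kE; lia.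
Qed.

Lemma count_neg_word w : w \in signed_perms n ->
  count (< 0) (word w) = #|[set i : pm n | (0 < val i) && (val (w i) < 0)]|.
Proof.
move=> /word_abs wa; rewrite -size_filter cardE.
rewrite -(size_map (fun i => val (w i))); apply/perm_size/uniq_perm.
- by apply/filter_uniq/(@map_uniq _ _ absz); rewrite (perm_uniq wa) iota_uniq.
- by rewrite map_inj_uniq ?enum_uniq // => i j /val_inj/perm_inj.
move=> y; rewrite mem_filter; apply/andP/mapP => [[y0 /(nthP 0)[m]]|[i]].
  rewrite size_word => mn; have [i iE] := pm_at mn.
  rewrite (nth_word _ iE) => yE; exists i => //.
  by rewrite mem_enum inE iE yE.
rewrite mem_enum inE => /andP[i0 wi] ->; split=> //.
have /andP[_ ib] := pm_bounds i.
have iE : val i = (`|val i|%N.-1).+1%:Z by move: (val i) i0; lia.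
by rewrite -(nth_word _ iE) mem_nth // size_word; move: (val i) i0 ib; lia.
Qed.

Lemma word_surj (s : seq int) : perm_eq (map absz s) (iota 1 n) ->
  exists2 w, w \in signed_perms n & word w = s.
Proof.
move=> sa; have sz : size s = n by rewrite -(size_map absz) (perm_size sa) size_iota.
have ua : uniq (map absz s) by rewrite (perm_uniq sa) iota_uniq.
(* The odd extension of [s] to negative positions. *)
pose f (i : pm n) : int := (-1) ^+ (val i < 0)%R * nth 0 s `|val i|.-1.
have lt_i (i : pm n) : (`|val i|.-1 < n)%N by have := pm_bounds i; lia.
have absf (i : pm n) : `|f i|%N = nth 0%N (map absz s) `|val i|.-1.
  by rewrite (nth_map 0) ?sz // abszMsign.
have fP (i : pm n) : f i \in pm_seq n.
  have : `|f i|%N \in iota 1 n by rewrite -(perm_mem sa) absf mem_nth // size_map sz.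
  by rewrite mem_pm_seq mem_iota add1n ltnS.
have f_inj : injective (fun i : pm n => Sub (f i) (fP i) : pm n).
  move=> i j /(congr1 val); rewrite !SubK => fE; apply: val_inj.
  have : `|val i|.-1 = `|val j|.-1.
    by apply: (uniqP 0%N ua); rewrite ?inE ?size_map ?sz // -!absf fE.
  (* With [i] and [j] equal up to sign, opposite signs would force [f i = - f i], but [f i] is
     nonzero. *)
  have := fP i; rewrite mem_pm_seq => fi0 ijE; move: fE fi0.
  rewrite /f ijE; have := pm_bounds i; have := pm_bounds j.
  move: ijE; move: (val i) (val j) => a b.
  by case: (ltP a 0); case: (ltP b 0); rewrite /= ?expr0 ?expr1 ?mul1r ?mulN1r; lia.
exists (perm f_inj).
  rewrite inE; apply/forallP => i; apply/eqP/val_inj.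
  rewrite !permE val_pm_opp !SubK /f val_pm_opp abszN.
  have := pm_bounds i; move: (val i) => a a0; rewrite oppr_lt0.
  by case: (ltgtP a 0) => // [_|_|a0']; rewrite ?a0' // in a0 *;
    rewrite /= ?expr0 ?expr1 ?mul1r ?mulN1r ?opprK.
apply: (@eq_from_nth _ 0); rewrite size_word ?sz // => m mn.
have [i iE] := pm_at mn; rewrite (nth_word _ iE) permE SubK /f iE.
by rewrite mul1r.
Qed.

End OneLineNotation.

Theorem theorem4p2 (k : nat) (hk : 1 <= k) : APS_B (2 * k) = APS_D (2 * k).
Proof.
apply/eqP; rewrite eqEsubset; apply/andP; split; apply/subsetP => P; last first.
  by case/imsetP => w; rewrite inE => /andP[wB _] ->; apply: imset_f.
case/imsetP => w wB ->.
have [odd_w|even_w] := boolP (odd (count (fun x : int => x < 0)%R (word w))); last first.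
  by apply: imset_f; rewrite inE wB -count_neg_word.
have [|| s [sa even_s sE]] := flip_sign_parity _ _ (word_abs wB) odd_w.
- by rewrite muln_gt0.
- by rewrite oddM.
have [w' w'B w's] := word_surj sa.
apply/imsetP; exists w'; first by rewrite inE w'B -count_neg_word // w's.
by apply/setP => i; rewrite !mem_pinnacle_set w's sE.
Qed.
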